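(* If $f\in\mathcal{B}$ has Taylor expansion $f(z)=\sum_{k\ge 0}a_kz^k$ at the origin, then $|a_3|\le 3.2888$.
   Context: Let $\mathbb{D}=\{z\in\mathbb{C}:|z|<1\}$. The class $\mathcal{B}$ is the set of all holomorphic functions $f:\mathbb{D}\to\mathbb{C}$ such that $f(0)=1$ and $(1-|z|^2)\,|f(z)|\le 1$ for all $z\in\mathbb{D}$. *)

(* Defs.v *)
From Stdlib Require Import Reals.
From Coquelicot Require Import Coquelicot.
Open Scope R_scope.

(* Functions on the disc are total functions [C -> C] constrained only on
   [unit_disc]; since the disc is open, differentiability at its points does
   not depend on the values outside. *)
Definition unit_disc (z : C) : Prop := Cmod z < 1.

(* [K] and [V] are explicit so that the derivative is the complex one. *)
Definition holomorphic_on (D : C -> Prop) (f : C -> C) : Prop :=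
  forall z : C, D z -> @ex_derive C_AbsRing C_NormedModule f z.

Definition class_B (f : C -> C) : Prop :=
  holomorphic_on unit_disc f /\
  f (RtoC 0) = RtoC 1 /\
  (forall z : C, unit_disc z -> (1 - Cmod z ^ 2) * Cmod (f z) <= 1).

(* [f z = a 0 + a 1 * z + a 2 * z^2 + ...] as a convergent series, at every
   point of the disc. *)
Definition taylor_expansion_on_disc (f : C -> C) (a : nat -> C) : Prop :=
  forall z : C, unit_disc z ->
    @is_pseries C_AbsRing C_NormedModule a z (f z).

(* Main.v *)
Require Import Defs.
From Stdlib Require Import Reals.
From Coquelicot Require Import Coquelicot.
From Stdlib Require Import ZArith Lia Lra List.
Import ListNotations.
Open Scope R_scope.

(** Why the bound holds. Rotating the disc makes the coefficient of [z^3] equal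
    to [|a 3|]. Averaging [f] over the rotations of order 3, and then over [f]
    and its mirror image [z |-> conj (f (conj z))], preserves the growth bound:
    one may thus assume that [f z] is the sum of the [b k * z^(3k)] with real
    [b k], where [b 0 = 1] and [b 1 = |a 3|].

    Bounding [b 1] is now a linear program with infinitely many unknowns: for
    every [z] in the disc and every complex [c], the sum of the
    [b k * Re (c * z^(3k))] is at most [|c| / (1 - |z|^2)]. Adding such
    constraints, with masses [c_j] at points [z_j], gives
    [s_0 * b 0 + s_1 * b 1 + s_2 * b 2 + ... <= sum_j |c_j| / (1 - |z_j|^2)],
    where [s_k] is the moment [sum_j Re (c_j * z_j^(3k))]. If the moments of
    order at least 2 were zero and [s_1] were 1, this would bound [b 1]. They
    need only be small, because Cauchy's estimate [cauchy_estimate] bounds the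
    [b k]: this is the lemma [duality].

    The theorem is then witnessed by one explicit measure [nu] with 27 points.
    Numerically the optimum of the linear program is close to 3.2864, which
    leaves enough room below 3.2888 for points on a coarse rational grid,
    masses rounded to 8 decimals and crude estimates of the remainder. All the
    quantities attached to [nu] are computed exactly in integers.

    Only power series are used. Both the averaging over rotations and Cauchy's
    estimate come from [bounded_by_sieve]: keeping the coefficients whose
    indices lie in a residue class modulo [N] amounts to averaging over the
    [N]-th roots of unity. *)

(** * Real series *)

Lemma is_series_0 (u : nat -> R) : (forall n, u n = 0) -> is_series u 0.
Proof.
  intros Hu.
  assert (Z : is_series (fun n => 0 * 0 ^ n) (0 * / (1 - 0))).
  { apply (is_series_scal_l (K := R_AbsRing) (V := R_NormedModule) 0
             (fun n => 0 ^ n)), is_series_geom.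
    rewrite Rabs_R0. lra. }
  rewrite !Rmult_0_l in Z. apply is_series_ext with (2 := Z).
  intros n. rewrite Hu. apply Rmult_0_l.
Qed.

Lemma is_series_Re (u : nat -> C) (l : C) :
  @is_series C_AbsRing C_NormedModule u l ->
  is_series (fun n => Re (u n)) (Re l).
Proof.
  intros H.
  assert (Hs : forall n, sum_n (fun k => Re (u k)) n =
                         Re (@sum_n C_NormedModule u n)).
  { induction n as [|n IH].
    - now rewrite !sum_O.
    - rewrite !sum_Sn, IH. reflexivity. }
  apply (filterlim_ext (fun n => Re (@sum_n C_NormedModule u n))).
  { intros n. symmetry. apply Hs. }
  apply filterlim_comp with (1 := H).
  apply filterlim_locally. intros eps.
  apply (locally_le_locally_norm (K := C_AbsRing) (V := C_NormedModule)).
  exists eps. intros y Hy.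
  unfold ball; simpl; unfold AbsRing_ball, abs, minus, plus, opp; simpl.
  apply Rle_lt_trans with (2 := Hy).
  exact (re_le_Cmod (y - l)%C).
Qed.

Lemma is_series_tail (u : nat -> R) (s A q : R) (K : nat) :
  0 <= q < 1 -> is_series u s ->
  (forall k, (K < k)%nat -> Rabs (u k) <= A * q ^ k) ->
  Rabs (s - sum_n u K) <= A * q ^ (K + 1) / (1 - q).
Proof.
  intros Hq Hu Hb.
  assert (Ht : is_series (fun k => u (S K + k)%nat) (s - sum_n u K)).
  { apply is_series_incr_n; [lia|]. simpl pred.
    match goal with |- is_series _ ?X => replace X with s; [exact Hu|] end.
    unfold plus; simpl. change (s = s - sum_n u K + sum_n u K). ring. }
  assert (Hg : is_series (fun k => A * q ^ (K + 1) * q ^ k)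
                 (A * q ^ (K + 1) * / (1 - q))).
  { apply (is_series_scal_l (K := R_AbsRing) (V := R_NormedModule)
             (A * q ^ (K + 1)) (fun k => q ^ k)), is_series_geom.
    rewrite Rabs_pos_eq; lra. }
  assert (Hle : forall k, 0 <= Rabs (u (S K + k)%nat) <=
                          A * q ^ (K + 1) * q ^ k).
  { intros k. split; [apply Rabs_pos|].
    eapply Rle_trans; [apply Hb; lia|].
    rewrite Rmult_assoc, <- pow_add.
    right. do 2 f_equal. lia. }
  rewrite <- (is_series_unique _ _ Ht).
  unfold Rdiv. rewrite <- (is_series_unique _ _ Hg).
  assert (Ex : ex_series (fun k => A * q ^ (K + 1) * q ^ k))
    by (eexists; exact Hg).
  apply Rle_trans with (Series (fun k => Rabs (u (S K + k)%nat))).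
  - apply Series_Rabs.
    apply (ex_series_le (K := R_AbsRing) (V := R_CompleteNormedModule))
      with (2 := Ex).
    intros k. unfold norm; simpl. unfold abs; simpl.
    rewrite Rabs_Rabsolu. apply Hle.
  - apply Series_le; [exact Hle | exact Ex].
Qed.

Lemma sum_n_single (u : nat -> R) (n K : nat) :
  (n <= K)%nat -> (forall m, (m <= K)%nat -> m <> n -> u m = 0) ->
  sum_n u K = u n.
Proof.
  assert (Z : forall K, (forall m, (m <= K)%nat -> u m = 0) -> sum_n u K = 0).
  { induction K0 as [|k IH]; intros H.
    - rewrite sum_O. apply H. lia.
    - rewrite sum_Sn, IH by (intros m Hm; apply H; lia).
      rewrite H by lia. unfold plus; simpl. ring. }
  induction K as [|K IH]; intros Hn H.
  - replace n with 0%nat by lia. apply sum_O.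
  - rewrite sum_Sn. unfold plus; simpl. destruct (Nat.eq_dec n (S K)) as [->|E].
    + rewrite Z by (intros m Hm; apply H; lia). ring.
    + rewrite IH by (try lia; intros m Hm; apply H; lia).
      rewrite (H (S K)) by lia. ring.
Qed.

Lemma is_series_bounded_terms (u : nat -> R) (s : R) :
  is_series u s -> exists A, forall n, Rabs (u n) <= A.
Proof.
  intros Hu.
  assert (L : is_lim_seq u 0) by (apply ex_series_lim_0; now exists s).
  apply is_lim_seq_Reals in L.
  destruct (maj_by_pos u (exist _ 0 L)) as [A [_ HA]].
  now exists A.
Qed.

Lemma is_series_multiples_of_3 (u : nat -> R) (s : R) :
  is_series u s -> (forall m, (m mod 3 <> 0)%nat -> u m = 0) ->
  is_series (fun k => u (3 * k)%nat) s.
Proof.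
  intros Hu H0.
  assert (E : forall k, sum_n u (3 * k) = sum_n (fun i => u (3 * i)%nat) k).
  { induction k as [|k IH].
    - now rewrite !sum_O.
    - replace (3 * S k)%nat with (S (S (S (3 * k)))) by lia.
      rewrite !sum_Sn, IH.
      rewrite (H0 (S (3 * k))), (H0 (S (S (3 * k)))).
      + replace (3 * S k)%nat with (S (S (S (3 * k)))) by lia.
        unfold plus; simpl. ring.
      + replace (S (S (3 * k))) with (2 + k * 3)%nat by lia.
        rewrite Nat.Div0.mod_add. discriminate.
      + replace (S (3 * k)) with (1 + k * 3)%nat by lia.
        rewrite Nat.Div0.mod_add. discriminate. }
  apply (filterlim_ext (fun k => sum_n u (3 * k))); [exact E|].
  apply filterlim_comp with (2 := Hu).
  apply eventually_subseq. intros n. lia.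
Qed.

(** * Coefficient sequences of bounded growth *)

(** [bounded_by M a]: the power series with coefficients [a] converges in the
    unit disc to a function of modulus at most [M / (1 - |z|^2)]. The value at
    [z] is seen only through its real-linear functionals [w |-> Re (c * w)], so
    that all the series involved are real. *)
Definition bounded_by (M : R) (a : nat -> C) : Prop :=
  forall c z : C, Cmod z < 1 -> exists s : R,
    is_series (fun n => Re (c * a n * z ^ n)%C) s /\
    (1 - Cmod z ^ 2) * Rabs s <= M * Cmod c.

Lemma bounded_by_ext (M : R) (a b : nat -> C) :
  (forall n, a n = b n) -> bounded_by M a -> bounded_by M b.
Proof.
  intros E H c z Hz. destruct (H c z Hz) as [s [H1 H2]].
  exists s; split; [|exact H2].
  apply is_series_ext with (2 := H1). intros n. now rewrite E.
Qed.

Lemma pow_n_Cpow (z : C) (n : nat) : @pow_n (AbsRing.Ring C_AbsRing) z n = (z ^ n)%C.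
Proof. induction n as [|n IH]; simpl; [reflexivity | now rewrite IH]. Qed.

Lemma one_minus_sqr_pos (x : R) : 0 <= x < 1 -> 0 < 1 - x ^ 2.
Proof. intros H; nra. Qed.

Lemma bounded_by_taylor (f : C -> C) (a : nat -> C) :
  class_B f -> taylor_expansion_on_disc f a -> bounded_by 1 a.
Proof.
  intros [_ [_ Hf]] Ha c z Hz.
  exists (Re (c * f z)%C); split.
  - generalize (is_series_Re _ _ (is_series_scal (K := C_AbsRing) c _ _ (Ha z Hz))).
    apply is_series_ext. intros n. f_equal.
    unfold scal; simpl; unfold mult; simpl.
    rewrite pow_n_Cpow. ring.
  - rewrite Rmult_1_l.
    pose proof (re_le_Cmod (c * f z)%C) as H1. rewrite Cmod_mult in H1.
    pose proof (Hf z Hz) as H2.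
    pose proof (Cmod_ge_0 c). pose proof (Cmod_ge_0 z).
    pose proof (one_minus_sqr_pos (Cmod z) (conj H0 Hz)).
    apply Rle_trans with ((1 - Cmod z ^ 2) * (Cmod c * Cmod (f z))).
    + apply Rmult_le_compat_l; lra.
    + nra.
Qed.

Lemma taylor_at_0 (f : C -> C) (a : nat -> C) :
  taylor_expansion_on_disc f a -> f 0 = 1%C -> a 0%nat = 1%C.
Proof.
  intros Ha Hf0. rewrite <- Hf0.
  assert (H0 : unit_disc 0) by (unfold unit_disc; rewrite Cmod_0; lra).
  symmetry.
  exact (filterlim_locally_unique (K := C_AbsRing) (V := C_NormedModule) _ _ _
    (Ha 0 H0) (is_pseries_0 (K := C_AbsRing) (V := C_NormedModule) a)).
Qed.

Lemma bounded_by_plus (M N : R) (a b : nat -> C) :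
  bounded_by M a -> bounded_by N b -> bounded_by (M + N) (fun n => a n + b n)%C.
Proof.
  intros Ha Hb c z Hz.
  destruct (Ha c z Hz) as [s [H1 H2]], (Hb c z Hz) as [t [H3 H4]].
  exists (s + t); split.
  - apply is_series_ext with (2 := is_series_plus _ _ _ _ H1 H3).
    intros n. unfold plus; simpl. ring.
  - pose proof (Rabs_triang s t).
    pose proof (one_minus_sqr_pos (Cmod z) (conj (Cmod_ge_0 z) Hz)). nra.
Qed.

Lemma bounded_by_scal (M : R) (u : C) (a : nat -> C) :
  bounded_by M a -> bounded_by (M * Cmod u) (fun n => u * a n)%C.
Proof.
  intros Ha c z Hz. destruct (Ha (c * u)%C z Hz) as [s [H1 H2]].
  exists s; split.
  - apply is_series_ext with (2 := H1). intros n. f_equal. ring.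
  - rewrite Cmod_mult in H2. lra.
Qed.

Lemma bounded_by_rotate (M : R) (v : C) (a : nat -> C) :
  Cmod v = 1 -> bounded_by M a -> bounded_by M (fun n => a n * v ^ n)%C.
Proof.
  intros Hv Ha c z Hz.
  destruct (Ha c (v * z)%C) as [s [H1 H2]].
  { now rewrite Cmod_mult, Hv, Rmult_1_l. }
  exists s; split.
  - apply is_series_ext with (2 := H1). intros n. f_equal.
    rewrite Cpow_mult_l. ring.
  - now rewrite Cmod_mult, Hv, Rmult_1_l in H2.
Qed.

Lemma bounded_by_conj (M : R) (a : nat -> C) :
  bounded_by M a -> bounded_by M (fun n => Cconj (a n)).
Proof.
  intros Ha c z Hz.
  destruct (Ha (Cconj c) (Cconj z)) as [s [H1 H2]].
  { now rewrite Cmod_conj. }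
  rewrite !Cmod_conj in H2. exists s; split; [|exact H2].
  apply is_series_ext with (2 := H1). intros n.
  rewrite <- (re_conj (c * _ * _)%C), !Cmult_conj, Cpow_conj, Cconj_conj.
  reflexivity.
Qed.

(** Taking real parts of the coefficients averages the function with its mirror
    image in the real axis. *)
Lemma bounded_by_Re (M : R) (a : nat -> C) :
  bounded_by M a -> bounded_by M (fun n => RtoC (Re (a n))).
Proof.
  intros Ha.
  apply (bounded_by_ext M (fun n => / 2 * (a n + Cconj (a n)))%C).
  { intros n. rewrite re_alt. unfold Cdiv. ring. }
  assert (H2 : RtoC 2 <> 0%C) by (intros E; apply RtoC_inj in E; lra).
  replace M with ((M + M) * Cmod (/ 2)%C)
    by (rewrite Cmod_inv, Cmod_R, Rabs_pos_eq by (exact H2 || lra); field).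
  apply bounded_by_scal, bounded_by_plus; [exact Ha | now apply bounded_by_conj].
Qed.

(** * Roots of unity *)

(** The point of argument [x] on the unit circle. *)
Definition cis (x : R) : C := (cos x, sin x).

Lemma cis_plus (x y : R) : cis (x + y) = (cis x * cis y)%C.
Proof.
  unfold cis, Cmult; simpl. rewrite cos_plus, sin_plus.
  apply f_equal2; ring.
Qed.

Lemma cis_0 : cis 0 = 1%C.
Proof. unfold cis. now rewrite cos_0, sin_0. Qed.

Lemma cis_pow (x : R) (n : nat) : (cis x ^ n)%C = cis (INR n * x).
Proof.
  induction n as [|n IH].
  - simpl. now rewrite Rmult_0_l, cis_0.
  - rewrite Cpow_S, IH, <- cis_plus, S_INR. f_equal. ring.
Qed.

Lemma Cmod_cis (x : R) : Cmod (cis x) = 1.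
Proof.
  unfold Cmod, cis; simpl fst; simpl snd.
  replace (cos x ^ 2 + sin x ^ 2) with 1; [apply sqrt_1|].
  pose proof (sin2_cos2 x) as H. unfold Rsqr in H. simpl. lra.
Qed.

Lemma cis_2PI_nat (n : nat) : cis (2 * PI * INR n) = 1%C.
Proof.
  rewrite Rmult_comm, <- cis_pow.
  replace (cis (2 * PI)) with (RtoC 1).
  - apply Cpow_1_l.
  - unfold cis. now rewrite cos_2PI, sin_2PI.
Qed.

Lemma cis_neq_1 (x : R) : - PI < x < PI -> x <> 0 -> cis (2 * x) <> 1%C.
Proof.
  intros Hx Hx0 E. apply (f_equal fst) in E. simpl in E.
  rewrite cos_2a_sin in E.
  assert (Hs : sin x <> 0).
  { destruct (Rtotal_order x 0) as [H|[H|H]]; [| lra |].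
    - pose proof (sin_gt_0 (- x)) as P. rewrite sin_neg in P. lra.
    - pose proof (sin_gt_0 x). lra. }
  apply Hs. nra.
Qed.

(** Rotating the disc by [v] turns the coefficient [w] of [z^3] into its
    modulus. *)
Lemma unimodular_cube_root (w : C) :
  exists v : C, Cmod v = 1 /\ (w * v ^ 3 = Cmod w)%C.
Proof.
  destruct (Ceq_dec w 0) as [->|Hw].
  { exists 1%C. split; [apply Cmod_1|]. rewrite Cmod_0. ring. }
  assert (Hm : 0 < Cmod w) by now apply Cmod_gt_0.
  assert (Hx : exists t, w = (Cmod w * cis t)%C).
  { destruct w as [x y]. set (m := Cmod (x, y)) in *.
    assert (Hxy : m ^ 2 = x ^ 2 + y ^ 2) by apply Cmod2_alt.
    assert (B : -1 <= x / m <= 1).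
    { split; apply Rmult_le_reg_r with m; try lra;
        unfold Rdiv; rewrite Rmult_assoc, Rinv_l by lra; nra. }
    assert (Hs : sin (acos (x / m)) = Rabs y / m).
    { rewrite sin_acos by exact B.
      replace (1 - (x / m)²) with ((Rabs y / m)²).
      - rewrite sqrt_Rsqr; [reflexivity|].
        apply Rdiv_le_0_compat; [apply Rabs_pos | lra].
      - rewrite !Rsqr_div', <- Rsqr_abs. unfold Rsqr.
        apply Rmult_eq_reg_r with (m * m); [|nra]. field_simplify; lra. }
    destruct (Rle_dec 0 y) as [Hy|Hy].
    - exists (acos (x / m)). unfold cis. rewrite cos_acos, Hs, Rabs_pos_eq by lra.
      unfold Cmult; simpl. f_equal; field; lra.
    - exists (- acos (x / m)). unfold cis.
      rewrite cos_neg, sin_neg, cos_acos, Hs, Rabs_left by lra.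
      unfold Cmult; simpl. f_equal; field; lra. }
  destruct Hx as [t Ht]. exists (cis (- (t / 3))). split; [apply Cmod_cis|].
  rewrite cis_pow, Ht at 1. rewrite <- Cmult_assoc, <- cis_plus.
  replace (t + INR 3 * - (t / 3)) with 0 by (simpl; field).
  rewrite cis_0. ring.
Qed.

(** The sum of [g j] over [j < N]. *)
Fixpoint csum (g : nat -> C) (N : nat) : C :=
  match N with O => 0%C | S N' => (csum g N' + g N')%C end.

Lemma csum_ext (g h : nat -> C) (N : nat) :
  (forall j, g j = h j) -> csum g N = csum h N.
Proof. intros E. induction N; simpl; [reflexivity | now rewrite IHN, E]. Qed.

Lemma csum_geom (q : C) (N : nat) :
  ((1 - q) * csum (fun j => q ^ j) N = 1 - q ^ N)%C.
Proof.
  induction N as [|N IH]; simpl csum.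
  - simpl. ring.
  - rewrite Cmult_plus_distr_l, IH, Cpow_S. ring.
Qed.

Lemma csum_one (N : nat) : csum (fun _ => 1%C) N = RtoC (INR N).
Proof.
  induction N as [|N IH]; [reflexivity|].
  simpl csum. now rewrite IH, S_INR, RtoC_plus.
Qed.

(** The sequence [a] restricted to the indices congruent to [r] modulo [N]. *)
Definition sieve (N r : nat) (a : nat -> C) (m : nat) : C :=
  if Nat.eqb (m mod N) r then a m else 0%C.

(** Orthogonality of characters: the sum over [j < N] of the [j]-th powers of
    [exp (2 i pi (m - r) / N)] detects whether [m] is congruent to [r]. *)
Lemma roots_of_unity_filter (N r m : nat) : (r < N)%nat ->
  csum (fun j => cis (2 * PI * (INR m - INR r) / INR N) ^ j)%C N =
  if Nat.eqb (m mod N) r then RtoC (INR N) else 0%C.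
Proof.
  intros HrN.
  assert (HN : 0 < INR N) by (apply lt_0_INR; lia).
  set (s := (m mod N)%nat).
  assert (Hs : (s < N)%nat) by (apply Nat.mod_upper_bound; lia).
  assert (E : cis (2 * PI * (INR m - INR r) / INR N) =
              cis (2 * (PI * (INR s - INR r) / INR N))).
  { pose proof (Nat.div_mod_eq m N) as D. fold s in D.
    replace (2 * PI * (INR m - INR r) / INR N) with
      (2 * PI * INR (m / N) + 2 * (PI * (INR s - INR r) / INR N)).
    - now rewrite cis_plus, cis_2PI_nat, Cmult_1_l.
    - apply (f_equal INR) in D. rewrite plus_INR, mult_INR in D. rewrite D.
      field. lra. }
  rewrite E. destruct (Nat.eqb_spec s r) as [->|Hsr].
  - replace (2 * (PI * (INR r - INR r) / INR N)) with 0 by (field; lra).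
    rewrite cis_0, <- csum_one. apply csum_ext. intros j. apply Cpow_1_l.
  - set (q := cis (2 * (PI * (INR s - INR r) / INR N))).
    assert (Hq : q <> 1%C).
    { pose proof PI_RGT_0 as HPI.
      pose proof (lt_INR _ _ Hs). pose proof (lt_INR _ _ HrN).
      pose proof (pos_INR s). pose proof (pos_INR r).
      assert (INR s - INR r <> 0).
      { intros D. apply Hsr, INR_eq. lra. }
      apply cis_neq_1.
      - split.
        + apply Rmult_lt_reg_r with (INR N); [lra|].
          unfold Rdiv. rewrite Rmult_assoc, Rinv_l by lra. nra.
        + apply Rmult_lt_reg_r with (INR N); [lra|].
          unfold Rdiv. rewrite Rmult_assoc, Rinv_l by lra. nra.
      - intros D. apply Rmult_integral in D.
        pose proof (Rinv_0_lt_compat _ HN).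
        destruct D as [D|D]; [apply Rmult_integral in D|]; lra. }
    assert (HqN : (q ^ N)%C = 1%C).
    { unfold q. rewrite cis_pow.
      replace (INR N * (2 * (PI * (INR s - INR r) / INR N))) with
        (2 * PI * INR s + - (2 * PI * INR r)) by (field; lra).
      rewrite cis_plus, cis_2PI_nat, Cmult_1_l.
      rewrite <- (Cmult_1_l (cis _)), <- (cis_2PI_nat r), <- cis_plus.
      rewrite Rplus_opp_r. rewrite cis_0. now rewrite cis_2PI_nat. }
    pose proof (csum_geom q N) as G. rewrite HqN in G.
    replace (csum (fun j : nat => (q ^ j)%C) N) with
      (/ (1 - q) * ((1 - q) * csum (fun j : nat => (q ^ j)%C) N))%C.
    + rewrite G. ring.
    + field. intros D. apply Hq. symmetry.
      rewrite <- (Cplus_0_l q), <- D. ring.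
Qed.

Lemma bounded_by_csum (M : R) (a : nat -> C) (u v : nat -> C) (N : nat) :
  (forall j, Cmod (u j) = 1) -> (forall j, Cmod (v j) = 1) ->
  bounded_by M a ->
  bounded_by (INR N * M) (fun m => a m * csum (fun j => u j * v j ^ m) N)%C.
Proof.
  intros Hu Hv Ha. induction N as [|N IH].
  - intros c z Hz. exists 0. split.
    + apply is_series_0. intros n. simpl csum.
      now rewrite Cmult_0_r, Cmult_0_r, Cmult_0_l.
    + rewrite Rabs_R0. simpl INR. pose proof (Cmod_ge_0 c). lra.
  - apply (bounded_by_ext _ (fun m => a m * csum (fun j => u j * v j ^ m) N
                                     + u N * (a m * v N ^ m))%C).
    { intros n. simpl csum. ring. }
    rewrite S_INR. replace ((INR N + 1) * M) with (INR N * M + M * Cmod (u N))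
      by (rewrite Hu; ring).
    apply bounded_by_plus; [exact IH|].
    apply (bounded_by_scal M (u N) (fun m => a m * v N ^ m)%C).
    now apply bounded_by_rotate.
Qed.

(** Sieving averages [N] rotated and rephased copies of the function, hence
    does not enlarge the growth constant. *)
Lemma bounded_by_sieve (M : R) (N r : nat) (a : nat -> C) :
  (r < N)%nat -> bounded_by M a -> bounded_by M (sieve N r a).
Proof.
  intros HrN Ha.
  assert (HN : 0 < INR N) by (apply lt_0_INR; lia).
  assert (HN' : RtoC (INR N) <> 0%C) by (intros E; apply RtoC_inj in E; lra).
  set (u := fun j => cis (- (INR j * (2 * PI * INR r / INR N)))).
  set (v := fun j => cis (INR j * (2 * PI / INR N))).
  apply (bounded_by_ext _ (fun m => / INR N *
           (a m * csum (fun j => u j * v j ^ m) N))%C).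
  - intros m. unfold sieve.
    rewrite (csum_ext _ (fun j => cis (2 * PI * (INR m - INR r) / INR N) ^ j)%C).
    + rewrite (roots_of_unity_filter N r m HrN).
      destruct (Nat.eqb (m mod N) r); [field; exact HN' | ring].
    + intros j. unfold u, v. rewrite !cis_pow, <- cis_plus. f_equal.
      field. lra.
  - replace M with ((INR N * M) * Cmod (/ INR N)%C).
    2:{ rewrite Cmod_inv, Cmod_R, Rabs_pos_eq by (try exact HN'; lra).
        field. lra. }
    apply bounded_by_scal, bounded_by_csum; try exact Ha;
      intros j; apply Cmod_cis.
Qed.

(** * Cauchy's estimate *)

Lemma bounded_by_terms (M : R) (a : nat -> C) (r : R) :
  bounded_by M a -> 0 <= r < 1 ->
  exists A, forall n, Cmod (a n) * r ^ n <= A.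
Proof.
  intros Ha Hr.
  assert (Hr' : Cmod r < 1) by (rewrite Cmod_R, Rabs_pos_eq; lra).
  destruct (Ha 1%C r Hr') as [s [HS _]], (Ha Ci r Hr') as [T [HT _]].
  destruct (is_series_bounded_terms _ _ HS) as [A HA].
  destruct (is_series_bounded_terms _ _ HT) as [B HB].
  exists (A + B). intros n.
  specialize (HA n). specialize (HB n).
  assert (E : Cmod (a n) * r ^ n = Cmod (a n * r ^ n)%C).
  { rewrite Cmod_mult, Cmod_pow, Cmod_R, Rabs_pos_eq by lra. reflexivity. }
  rewrite E. clear E.
  replace (1 * a n * r ^ n)%C with (a n * r ^ n)%C in HA by ring.
  replace (Ci * a n * r ^ n)%C with (Ci * (a n * r ^ n))%C in HB by ring.
  destruct (a n * r ^ n)%C as [x y]. unfold Re, Ci, Cmult in *. simpl in *.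
  replace (0 * x - 1 * y) with (- y) in HB by ring. rewrite Rabs_Ropp in HB.
  apply Rle_trans with (Rabs x + Rabs y); [|lra].
  replace (x, y) with ((x, 0) + (0, y))%C by (unfold Cplus; simpl; f_equal; ring).
  apply Rle_trans with (1 := Cmod_triangle _ _).
  unfold Cmod; simpl fst; simpl snd.
  replace (x ^ 2 + 0 ^ 2) with (Rsqr x) by (unfold Rsqr; ring).
  replace (0 ^ 2 + y ^ 2) with (Rsqr y) by (unfold Rsqr; ring).
  rewrite !sqrt_Rsqr_abs. lra.
Qed.

(** Sieving modulo [N + 1] isolates the coefficient of index [n] up to the
    coefficients of index greater than [N], whose contribution on the circle of
    radius [r] tends to 0. No contour integral is needed. *)
Lemma cauchy_estimate (M : R) (a : nat -> C) (r : R) (n : nat) :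
  bounded_by M a -> 0 < r < 1 -> Cmod (a n) * r ^ n * (1 - r ^ 2) <= M.
Proof.
  intros Ha Hr.
  (* boundedness of the terms on a larger circle gives a geometric tail on the
     circle of radius [r] *)
  set (r' := (1 + r) / 2). set (q := r / r').
  assert (Hr' : 0 < r' < 1) by (unfold r'; lra).
  assert (Hq : 0 < q < 1).
  { unfold q. split; [apply Rdiv_lt_0_compat; lra|].
    apply Rmult_lt_reg_r with r'; [lra|]. unfold Rdiv.
    rewrite Rmult_assoc, Rinv_l by lra. unfold r'. lra. }
  destruct (bounded_by_terms M a r' Ha (conj (Rlt_le _ _ (proj1 Hr')) (proj2 Hr')))
    as [A HA].
  assert (HA' : forall m, Cmod (a m) * r ^ m <= A * q ^ m).
  { intros m. replace r with (r' * q) by (unfold q; field; lra).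
    rewrite Rpow_mult_distr. pose proof (pow_le q m (Rlt_le _ _ (proj1 Hq))).
    specialize (HA m). nra. }
  pose proof (Cmod_ge_0 (a n)) as Hn0.
  destruct (Req_dec (Cmod (a n)) 0) as [E0|E0].
  { rewrite E0. destruct (Ha 1%C r) as [s [_ HS]].
    { rewrite Cmod_R, Rabs_pos_eq; lra. }
    rewrite Cmod_R, Rabs_pos_eq, Cmod_1 in HS by lra.
    pose proof (Rabs_pos s). pose proof (one_minus_sqr_pos r). nra. }
  assert (Haliased : forall N, (n < N)%nat ->
    Cmod (a n) * r ^ n * (1 - r ^ 2) <= M + A * q ^ (N + 1) / (1 - q)).
  { intros N HN.
    (* the multiplier [Cconj (a n)] makes the term of index [n] equal to
       [|a n|^2 r^n] *)
    destruct (bounded_by_sieve M (S N) n a ltac:(lia) Ha (Cconj (a n)) r)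
      as [s [HS1 HS2]].
    { rewrite Cmod_R, Rabs_pos_eq; lra. }
    rewrite Cmod_conj, Cmod_R, Rabs_pos_eq in HS2 by lra.
    pose proof (is_series_tail _ s (Cmod (a n) * A) q N
                  (conj (Rlt_le _ _ (proj1 Hq)) (proj2 Hq)) HS1) as HT.
    rewrite (sum_n_single _ n N) in HT.
    - assert (Es : sieve (S N) n a n = a n)
        by (unfold sieve; now rewrite Nat.mod_small, Nat.eqb_refl by lia).
      rewrite Es in HT.
      replace (Re (Cconj (a n) * a n * r ^ n)%C) with
        (Cmod (a n) * (Cmod (a n) * r ^ n)) in HT.
      2:{ rewrite (Cmult_comm (Cconj _)), <- Cmod2_conj, <- !RtoC_pow, <- RtoC_mult.
          simpl. ring. }
      assert (HT' := HT ltac:(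
        intros k Hk; apply Rle_trans with (1 := re_le_Cmod _);
        rewrite !Cmod_mult, Cmod_conj, Cmod_pow, Cmod_R, Rabs_pos_eq by lra;
        rewrite Rmult_assoc, (Rmult_assoc _ A);
        apply Rmult_le_compat_l; [exact Hn0|];
        apply Rle_trans with (2 := HA' k);
        apply Rmult_le_compat_r; [apply pow_le; lra|];
        unfold sieve; destruct (Nat.eqb _ _);
        [lra | rewrite Cmod_0; apply Cmod_ge_0])).
      clear HT. pose proof (one_minus_sqr_pos r ltac:(lra)) as Hp.
      assert (H1 : 1 - r ^ 2 <= 1) by (pose proof (pow2_ge_0 r); lra).
      set (T := A * q ^ (N + 1) / (1 - q)).
      replace (Cmod (a n) * A * q ^ (N + 1) / (1 - q)) with (Cmod (a n) * T)
        in HT' by (unfold T; field; lra).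
      apply Rmult_le_reg_l with (Cmod (a n)); [lra|].
      assert (HT0 : 0 <= Cmod (a n) * T)
        by (apply Rle_trans with (2 := HT'); apply Rabs_pos).
      set (X := Cmod (a n) * (Cmod (a n) * r ^ n)) in *.
      assert (HX : X <= Rabs s + Cmod (a n) * T).
      { pose proof (Rle_abs s). pose proof (Rabs_minus_sym s X) as P.
        rewrite P in HT'. pose proof (Rle_abs (X - s)). lra. }
      replace (Cmod (a n) * (Cmod (a n) * r ^ n * (1 - r ^ 2))) with
        ((1 - r ^ 2) * X) by (unfold X; ring).
      nra.
    - lia.
    - intros m Hm Hmn. unfold sieve. rewrite Nat.mod_small by lia.
      destruct (Nat.eqb_spec m n); [contradiction|].
      rewrite Cmult_0_r, Cmult_0_l. reflexivity. }
  (* the aliasing error vanishes as the order [N + 1] of the roots of unity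
     grows *)
  apply (is_lim_seq_le_loc (fun _ => Cmod (a n) * r ^ n * (1 - r ^ 2))
           (fun N => M + A * q ^ (N + 1) / (1 - q))
           (Cmod (a n) * r ^ n * (1 - r ^ 2)) M).
  - exists (S n). intros N HN. apply Haliased. lia.
  - apply is_lim_seq_const.
  - replace (Finite M) with (Rbar_plus M (Rbar_mult (A * q / (1 - q)) 0))
      by (simpl; f_equal; ring).
    apply is_lim_seq_plus'; [apply is_lim_seq_const|].
    apply is_lim_seq_ext with (fun N => A * q / (1 - q) * q ^ N).
    + intros N. rewrite pow_add. field. lra.
    + simpl Rbar_mult.
      apply (is_lim_seq_scal_l _ (A * q / (1 - q)) 0), is_lim_seq_geom.
      rewrite Rabs_pos_eq; lra.
Qed.

(** * Discrete measures on the disc *)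

(** Gaussian integers, as pairs of a real and an imaginary part. *)
Definition gauss : Type := (Z * Z)%type.

Definition gmul (x y : gauss) : gauss :=
  ((fst x * fst y - snd x * snd y)%Z, (fst x * snd y + snd x * fst y)%Z).

Definition toC (x : gauss) : C := (IZR (fst x), IZR (snd x)).

Lemma toC_gmul (x y : gauss) : toC (gmul x y) = (toC x * toC y)%C.
Proof.
  unfold toC, gmul, Cmult; simpl.
  now rewrite minus_IZR, plus_IZR, !mult_IZR.
Qed.

Definition norm2 (x : gauss) : Z := (fst x * fst x + snd x * snd x)%Z.

Lemma Cmod_toC_sqr (x : gauss) : Cmod (toC x) ^ 2 = IZR (norm2 x).
Proof.
  rewrite Cmod2_alt. unfold norm2, toC. simpl fst; simpl snd.
  rewrite plus_IZR, !mult_IZR. unfold Re, Im; simpl. ring.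
Qed.

(** A finitely supported complex measure: a list of pairs [(c, p)], standing
    for the mass [c] at the point [p / 100]. *)
Definition measure : Type := list (gauss * gauss).

Definition point (nd : gauss * gauss) : C := (toC (snd nd) / 100)%C.

(** The real part of the integral of [z^(3k)]; the points are raised to
    multiples of 3 only, which are the indices left by the averaging over the
    rotations of order 3. *)
Definition moment (l : measure) (k : nat) : R :=
  fold_right (fun nd s => Re (toC (fst nd) * point nd ^ (3 * k))%C + s) 0 l.

Lemma moment_cons (nd : gauss * gauss) (l : measure) (k : nat) :
  moment (nd :: l) k = Re (toC (fst nd) * point nd ^ (3 * k))%C + moment l k.
Proof. reflexivity. Qed.

(** An integer upper bound of the modulus. *)
Definition mass_bound (c : gauss) : Z := (Z.sqrt (norm2 c) + 1)%Z.

Lemma Cmod_le_mass_bound (c : gauss) : Cmod (toC c) <= IZR (mass_bound c).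
Proof.
  assert (Hn : (0 <= norm2 c)%Z) by (unfold norm2; nia).
  assert (0 <= IZR (mass_bound c)).
  { apply IZR_le. unfold mass_bound. pose proof (Z.sqrt_nonneg (norm2 c)). lia. }
  apply Rsqr_incr_0; [| apply Cmod_ge_0 | exact H].
  rewrite !Rsqr_pow2, Cmod_toC_sqr.
  replace (IZR (mass_bound c) ^ 2) with (IZR (mass_bound c * mass_bound c))
    by (rewrite mult_IZR; ring).
  apply IZR_le. unfold mass_bound.
  pose proof (Z.sqrt_spec _ Hn). unfold Z.succ in *. lia.
Qed.

(** An upper bound of the total variation. *)
Definition total_mass (l : measure) : Z :=
  fold_right (fun nd s => (mass_bound (fst nd) + s)%Z) 0%Z l.

(** An upper bound of the integral of [1 / (1 - |z|^2)] against the total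
    variation, for a measure supported in the unit disc; each term is rounded
    up to an integer, and the factor 10000 is the square of the denominator
    of the points. *)
Definition total_cost (l : measure) : Z :=
  fold_right (fun nd s =>
    (mass_bound (fst nd) * 10000 / (10000 - norm2 (snd nd)) + 1 + s)%Z) 0%Z l.

Lemma pow_div (x y : R) (n : nat) : (x / y) ^ n = x ^ n / y ^ n.
Proof. unfold Rdiv. now rewrite Rpow_mult_distr, pow_inv. Qed.

Lemma div_le_IZR (x y : Z) : (0 < y)%Z -> IZR x / IZR y <= IZR (x / y + 1).
Proof.
  intros Hy. assert (0 < IZR y) by now apply IZR_lt.
  apply Rmult_le_reg_r with (IZR y); [assumption|].
  unfold Rdiv. rewrite Rmult_assoc, Rinv_l, Rmult_1_r by lra.
  rewrite <- mult_IZR. apply IZR_le.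
  pose proof (Z.mul_succ_div_gt x y Hy). lia.
Qed.

(** The support lies in the disc of radius 9/10. *)
Definition in_disc (l : measure) : Prop :=
  List.Forall (fun nd => (norm2 (snd nd) <= 8100)%Z) l.

Lemma Cmod_point_sqr (nd : gauss * gauss) :
  Cmod (point nd) ^ 2 = IZR (norm2 (snd nd)) / 10000.
Proof.
  assert (H100 : RtoC 100 <> 0%C) by (intros E; apply RtoC_inj in E; lra).
  unfold point. rewrite Cmod_div, Cmod_R, Rabs_pos_eq by (exact H100 || lra).
  rewrite <- Cmod_toC_sqr. field.
Qed.

Lemma Cmod_point_le (nd : gauss * gauss) :
  (norm2 (snd nd) <= 8100)%Z -> Cmod (point nd) <= 9 / 10.
Proof.
  intros H. apply IZR_le in H. pose proof (Cmod_point_sqr nd) as E.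
  pose proof (Cmod_ge_0 (point nd)). nra.
Qed.

Lemma Rabs_moment_le (l : measure) (k : nat) :
  in_disc l -> Rabs (moment l k) <= IZR (total_mass l) * (729 / 1000) ^ k.
Proof.
  intros H. induction H as [|nd l Hnd _ IH].
  - unfold moment, total_mass; simpl. rewrite Rabs_R0. lra.
  - rewrite moment_cons. simpl total_mass. rewrite plus_IZR, Rmult_plus_distr_r.
    apply Rle_trans with (1 := Rabs_triang _ _).
    apply Rplus_le_compat; [|exact IH].
    apply Rle_trans with (1 := re_le_Cmod _).
    rewrite Cmod_mult, Cmod_pow.
    apply Rmult_le_compat; [apply Cmod_ge_0 | apply pow_le, Cmod_ge_0
                           | apply Cmod_le_mass_bound |].
    replace (729 / 1000) with ((9 / 10) ^ 3) by field.
    rewrite <- pow_mult. apply pow_incr.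
    split; [apply Cmod_ge_0 | now apply Cmod_point_le].
Qed.

(** The growth bound integrated against the measure: the sum of the
    [b k * moment l k] is at most the cost. *)
Lemma moment_series_le (b : nat -> R) (l : measure) :
  in_disc l ->
  (forall c z : C, Cmod z < 1 -> exists s,
     is_series (fun k => b k * Re (c * z ^ (3 * k))%C) s /\
     (1 - Cmod z ^ 2) * Rabs s <= Cmod c) ->
  exists s, is_series (fun k => b k * moment l k) s /\ s <= IZR (total_cost l).
Proof.
  intros H Hb. induction H as [|nd l Hnd _ [s [Hs1 Hs2]]].
  - exists 0. split; [|apply Rle_refl].
    apply is_series_0. intros k. unfold moment; simpl. ring.
  - pose proof (Cmod_point_le nd Hnd) as Hp.
    destruct (Hb (toC (fst nd)) (point nd)) as [t [Ht1 Ht2]]; [lra|].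
    exists (t + s). split.
    + apply is_series_ext with (2 := is_series_plus _ _ _ _ Ht1 Hs1).
      intros k. rewrite moment_cons. symmetry. apply Rmult_plus_distr_l.
    + simpl total_cost. rewrite plus_IZR. apply Rplus_le_compat; [|exact Hs2].
      apply Rle_trans with (2 := div_le_IZR (mass_bound (fst nd) * 10000)
                                   (10000 - norm2 (snd nd)) ltac:(lia)).
      rewrite Cmod_point_sqr in Ht2. apply IZR_le in Hnd.
      rewrite mult_IZR, minus_IZR.
      pose proof (Cmod_le_mass_bound (fst nd)). pose proof (Rle_abs t).
      apply Rmult_le_reg_r with (10000 - IZR (norm2 (snd nd))); [lra|].
      unfold Rdiv at 1. rewrite Rmult_assoc, Rinv_l, Rmult_1_r by lra. nra.
Qed.

(** * Computing the moments *)

(** The moments of all orders are produced by iterating [step] on the list of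
    the pairs [(c * w^k, w)], where [w] is the cube of the integral point: the
    trace, which adds up the real parts of the first components, is the moment
    of order [k] times [100^(3k)]. *)
Definition state : Type := list (gauss * gauss).

Definition start (l : measure) : state :=
  map (fun nd => (fst nd, gmul (snd nd) (gmul (snd nd) (snd nd)))) l.

Definition step (st : state) : state :=
  map (fun cw => (gmul (fst cw) (snd cw), snd cw)) st.

Definition trace (st : state) : Z :=
  fold_right (fun cw s => (fst (fst cw) + s)%Z) 0%Z st.

Lemma IZR_trace_iter (l : measure) (k : nat) :
  IZR (trace (Nat.iter k step (start l))) = moment l k * (10 ^ 6) ^ k.
Proof.
  set (F := fun nd : gauss * gauss =>
    let w := gmul (snd nd) (gmul (snd nd) (snd nd)) in
    (Nat.iter k (fun c => gmul c w) (fst nd), w)).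
  assert (E : Nat.iter k step (start l) = map F l).
  { unfold F; clear F. induction k as [|k IH]; [reflexivity|].
    change (Nat.iter (S k) step (start l)) with (step (Nat.iter k step (start l))).
    rewrite IH. unfold step. now rewrite map_map. }
  rewrite E. clear E. induction l as [|nd l IH].
  { unfold moment; simpl. ring. }
  change (trace (map F (nd :: l))) with (fst (fst (F nd)) + trace (map F l))%Z.
  rewrite plus_IZR, IH, moment_cons, Rmult_plus_distr_r. f_equal.
  unfold F; simpl fst. clear F IH.
  set (w := gmul (snd nd) (gmul (snd nd) (snd nd))).
  assert (Ew : (toC w = point nd ^ 3 * (10 ^ 6)%R)%C).
  { unfold w, point. rewrite !toC_gmul.
    replace (RtoC (10 ^ 6)) with (100 * 100 * 100)%C
      by (rewrite <- !RtoC_mult; f_equal; ring).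
    simpl. field. }
  assert (Ek : (toC (Nat.iter k (fun c => gmul c w) (fst nd)) =
                toC (fst nd) * point nd ^ (3 * k) * ((10 ^ 6) ^ k)%R)%C).
  { induction k as [|k IH].
    - simpl. ring.
    - change (Nat.iter (S k) (fun c => gmul c w) (fst nd)) with
        (gmul (Nat.iter k (fun c => gmul c w) (fst nd)) w).
      rewrite toC_gmul, IH, Ew.
      replace (3 * S k)%nat with (3 + 3 * k)%nat by lia.
      rewrite Cpow_add_r, <- !tech_pow_Rmult, !RtoC_mult. ring. }
  change (IZR (fst (Nat.iter k (fun c => gmul c w) (fst nd)))) with
    (Re (toC (Nat.iter k (fun c => gmul c w) (fst nd)))).
  rewrite Ek. unfold Re, Cmult; simpl. ring.
Qed.

(** An upper bound of the sum of the [|trace| / V] along [K] steps, [V] being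
    multiplied by [941192 = 98^3] at each of them. The factor is that of
    Cauchy's estimate on the circle of radius 98/100. *)
Fixpoint residual (K : nat) (V : Z) (st : state) : Z :=
  match K with
  | O => 0%Z
  | S K' => (Z.abs (trace st) / V + 1 + residual K' (V * 941192) (step st))%Z
  end.

Lemma residual_S (K : nat) (V : Z) (st : state) :
  residual (S K) V st =
  (Z.abs (trace st) / V + 1 + residual K (V * 941192) (step st))%Z.
Proof. reflexivity. Qed.

(** The terms of index [j + 1] to [j + K], when Cauchy's estimate has reduced
    each of them to a trace. *)
Lemma sum_le_residual (l : measure) (u : nat -> R) (A : R) (K j : nat) :
  0 <= A ->
  (forall k, Rabs (u k) <=
     A * (Rabs (IZR (trace (Nat.iter k step (start l)))) / 941192 ^ k)) ->
  Rabs (sum_n_m u (S j) (j + K)) <=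
    A * IZR (residual K (941192 ^ Z.of_nat (S j)) (Nat.iter (S j) step (start l))).
Proof.
  intros HA Hu. revert j. induction K as [|K IH]; intros j.
  - rewrite sum_n_m_zero by lia. unfold zero; simpl. rewrite Rabs_R0. lra.
  - rewrite sum_Sn_m by lia. unfold plus; simpl AbelianMonoid.plus.
    apply Rle_trans with (1 := Rabs_triang _ _).
    rewrite residual_S, plus_IZR, Rmult_plus_distr_l.
    apply Rplus_le_compat.
    + apply Rle_trans with (1 := Hu (S j)).
      apply Rmult_le_compat_l; [exact HA|].
      eapply Rle_trans; [|apply div_le_IZR; apply Z.pow_pos_nonneg; lia].
      rewrite abs_IZR, <- pow_IZR. apply Rle_refl.
    + specialize (IH (S j)).
      replace (j + S K)%nat with (S j + K)%nat by lia.
      replace (941192 ^ Z.of_nat (S j) * 941192)%Z with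
        (941192 ^ Z.of_nat (S (S j)))%Z.
      * exact IH.
      * rewrite (Nat2Z.inj_succ (S j)), Z.pow_succ_r by lia. ring.
Qed.

(** * The dual bound *)

(** Weak duality. The moments of order 2 to [K + 1] are multiplied by the
    coefficients that Cauchy's estimate allows on the circle of radius 98/100,
    where [1 / (1 - (98/100)^2) = 2500/99]; the moments of higher order are
    bounded by a geometric series of ratio
    [(90/98)^3 = 91125 / 117649]. *)
Lemma duality (b : nat -> R) (l : measure) (K : nat) :
  in_disc l ->
  (forall c z : C, Cmod z < 1 -> exists s,
     is_series (fun k => b k * Re (c * z ^ (3 * k))%C) s /\
     (1 - Cmod z ^ 2) * Rabs s <= Cmod c) ->
  (forall k, Rabs (b k) * (98 / 100) ^ (3 * k) * (1 - (98 / 100) ^ 2) <= 1) ->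
  b 0%nat * moment l 0 + b 1%nat * moment l 1 <=
    IZR (total_cost l) +
    2500 / 99 * (IZR (residual K (941192 ^ 2) (step (step (start l)))) +
      IZR (total_mass l) * (91125 / 117649) ^ (K + 2) / (26524 / 117649)).
Proof.
  intros Hl Hb Hc.
  destruct (moment_series_le b l Hl Hb) as [s [Hs1 Hs2]].
  assert (HV : forall k, 0 < 941192 ^ k) by (intros k; apply pow_lt; lra).
  assert (Hb' : forall k, Rabs (b k) <= 2500 / 99 * ((10 ^ 6) ^ k / 941192 ^ k)).
  { intros k. specialize (Hc k). specialize (HV k).
    rewrite pow_mult in Hc.
    replace ((98 / 100) ^ 3) with (941192 / 10 ^ 6) in Hc by field.
    rewrite pow_div in Hc.
    assert (HT : 0 < (10 ^ 6) ^ k) by (apply pow_lt; lra).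
    apply Rmult_le_reg_r with (941192 ^ k / (10 ^ 6) ^ k * (1 - (98 / 100) ^ 2)).
    - apply Rmult_lt_0_compat; [now apply Rdiv_lt_0_compat | lra].
    - rewrite <- Rmult_assoc. apply Rle_trans with (1 := Hc).
      right. field. lra. }
  assert (Htr : forall k, Rabs (b k * moment l k) <=
    2500 / 99 * (Rabs (IZR (trace (Nat.iter k step (start l)))) / 941192 ^ k)).
  { intros k. specialize (HV k).
    assert (HT : 0 < (10 ^ 6) ^ k) by (apply pow_lt; lra).
    rewrite IZR_trace_iter, !Rabs_mult, (Rabs_pos_eq ((10 ^ 6) ^ k)) by lra.
    apply Rle_trans with (2500 / 99 * ((10 ^ 6) ^ k / 941192 ^ k) * Rabs (moment l k)).
    - apply Rmult_le_compat_r; [apply Rabs_pos | apply Hb'].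
    - right. field. lra. }
  assert (Htail : forall k, (K + 1 < k)%nat -> Rabs (b k * moment l k) <=
    2500 / 99 * IZR (total_mass l) * (91125 / 117649) ^ k).
  { intros k _. specialize (HV k).
    replace (91125 / 117649) with (729 / 1000 * (10 ^ 6 / 941192)) by field.
    rewrite Rpow_mult_distr, (pow_div (10 ^ 6)).
    rewrite Rabs_mult.
    apply Rle_trans with (2500 / 99 * ((10 ^ 6) ^ k / 941192 ^ k) *
                          (IZR (total_mass l) * (729 / 1000) ^ k)).
    - apply Rmult_le_compat; try apply Rabs_pos; [apply Hb' | now apply Rabs_moment_le].
    - right. ring. }
  pose proof (is_series_tail _ s _ (91125 / 117649) (K + 1) ltac:(lra) Hs1 Htail) as HT.
  pose proof (sum_le_residual l (fun k => b k * moment l k) (2500 / 99) K 1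
                ltac:(lra) Htr) as HR.
  unfold sum_n in HT. rewrite !sum_Sn_m in HT by lia.
  replace (K + 1)%nat with (1 + K)%nat in HT by lia.
  set (X := sum_n_m (fun k => b k * moment l k) 2 (1 + K)) in *.
  change (Z.of_nat 2) with 2%Z in HR.
  change (Nat.iter 2 step (start l)) with (step (step (start l))) in HR.
  unfold plus in HT; simpl AbelianMonoid.plus in HT.
  replace (1 + K + 1)%nat with (K + 2)%nat in HT by lia.
  replace (1 - 91125 / 117649) with (26524 / 117649) in HT by field.
  set (T := IZR (total_mass l) * (91125 / 117649) ^ (K + 2) / (26524 / 117649)).
  replace (2500 / 99 * IZR (total_mass l) * (91125 / 117649) ^ (K + 2) / (26524 / 117649))
    with (2500 / 99 * T) in HT by (unfold T; field).
  apply Rabs_le_between in HT. apply Rabs_le_between in HR.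
  cbv beta in HT. simpl in HT, HR |- *. lra.
Qed.

(** A nearly optimal measure for the problem of maximising [b 1] when
    [b 0 = 1]. It is a numerical solution of the linear program restricted to
    the points of the grid of mesh 1/100 in the disc of radius 9/10, multiplied
    by [10^8] and rounded to make the masses Gaussian integers. Nothing below
    depends on the way it was found. *)
Definition nu : measure :=
  [((978624923, 0), (44, 0)); ((24964622, 8815256), (-9, 68));
   ((18843690, -6750463), (-55, 42)); ((6525191, 6156000), (4, 77));
   ((1363604, -2826022), (-76, 29)); ((-200585, -1033608), (-83, 19));
   ((166748, -1047698), (61, 57)); ((-385829, 702103), (30, 81));
   ((-452531, 452298), (34, 80)); ((-477853, -191241), (48, 73));
   ((65898, -473480), (-80, 24)); ((-320013, -35506), (45, 75));
   ((-22363, -381944), (-82, 21)); ((-251220, 156903), (37, 79));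
   ((352713, -337392), (-69, 35)); ((-151041, 24363), (42, 77));
   ((112099, 19489), (-59, 64)); ((58472, -6543), (-25, 83));
   ((37482, -22500), (-31, 84)); ((15910, 25152), (-54, 72));
   ((22582, -8147), (86, 26)); ((-450, -22131), (-39, 81));
   ((15837, -4753), (80, 41)); ((-6150, -12433), (-41, 80));
   ((-10880, 0), (90, 0)); ((1578, -4609), (-37, 82));
   ((863, -626), (-32, 84))]%Z.

Lemma nu_in_disc : in_disc nu.
Proof. unfold in_disc, nu. repeat constructor; discriminate. Qed.

(** The moments of order 0 and 1, the latter being close to 1 up to the factors
    [10^8] of the masses and [10^6] of the trace. The moments of order 2 to 59
    are negligible: 58 units out of 404 are due to the rounding in
    [residual]. *)
Lemma nu_values :
  trace (start nu) = 1028893297%Z /\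
  trace (step (start nu)) = 99999999791457%Z /\
  total_cost nu = 1357649473%Z /\
  total_mass nu = 1043753901%Z /\
  residual 58 (941192 ^ 2) (step (step (start nu))) = 404%Z.
Proof. vm_compute. repeat split. Qed.

Lemma geometric_tail_small : (91125 / 117649) ^ 60 <= 3 / 10 ^ 7.
Proof.
  apply Rle_trans with ((36 / 100) ^ 15).
  - change 60%nat with (4 * 15)%nat. rewrite pow_mult. apply pow_incr. lra.
  - lra.
Qed.

Theorem theorem1p3 (f : C -> C) (a : nat -> C) (hf : class_B f)
    (ha : taylor_expansion_on_disc f a) :
  Cmod (a 3%nat) <= 3.2888.
Proof.
  assert (Ha : bounded_by 1 a) by exact (bounded_by_taylor f a hf ha).
  assert (Ha0 : a 0%nat = 1%C).
  { destruct hf as [_ [Hf0 _]]. exact (taylor_at_0 f a ha Hf0). }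
  destruct (unimodular_cube_root (a 3%nat)) as [v [Hv Hv3]].
  (* averaging over the rotations of order 3 and over the mirror image *)
  set (a' := fun n => RtoC (Re (sieve 3 0 (fun m => (a m * v ^ m)%C) n))).
  assert (Ha' : bounded_by 1 a').
  { apply bounded_by_Re, bounded_by_sieve; [lia|].
    now apply bounded_by_rotate. }
  set (b := fun k => Re (a' (3 * k)%nat)).
  assert (Hb : forall c z : C, Cmod z < 1 -> exists s,
     is_series (fun k => b k * Re (c * z ^ (3 * k))%C) s /\
     (1 - Cmod z ^ 2) * Rabs s <= Cmod c).
  { intros c z Hz. destruct (Ha' c z Hz) as [s [Hs1 Hs2]].
    exists s. split; [|lra].
    apply is_series_multiples_of_3 in Hs1.
    - apply is_series_ext with (2 := Hs1). intros k. unfold b, a'.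
      rewrite (Cmult_comm c (RtoC _)), <- Cmult_assoc, re_scal_l. reflexivity.
    - intros m Hm. unfold a', sieve.
      destruct (Nat.eqb_spec (m mod 3) 0) as [E|_]; [contradiction|].
      change (Re 0) with 0. rewrite Cmult_0_r, Cmult_0_l. reflexivity. }
  assert (Hc : forall k,
     Rabs (b k) * (98 / 100) ^ (3 * k) * (1 - (98 / 100) ^ 2) <= 1).
  { intros k.
    generalize (cauchy_estimate 1 a' (98 / 100) (3 * k) Ha' ltac:(lra)).
    unfold b, a'. now rewrite Cmod_R. }
  pose proof (duality b nu 58 nu_in_disc Hb Hc) as D.
  assert (Hb0 : b 0%nat = 1).
  { unfold b, a', sieve. simpl. rewrite Ha0. simpl. ring. }
  assert (Hb1 : b 1%nat = Cmod (a 3%nat)).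
  { change (b 1%nat) with (Re (a 3%nat * v ^ 3)%C). now rewrite Hv3. }
  destruct nu_values as [E0 [E1 [E2 [E3 E4]]]].
  pose proof (IZR_trace_iter nu 0) as M0.
  pose proof (IZR_trace_iter nu 1) as M1.
  change (Nat.iter 0 step (start nu)) with (start nu) in M0.
  change (Nat.iter 1 step (start nu)) with (step (start nu)) in M1.
  rewrite E0 in M0. rewrite E1 in M1. rewrite E2, E3, E4, Hb0, Hb1 in D.
  pose proof geometric_tail_small as T.
  change (58 + 2)%nat with 60%nat in D.
  rewrite pow_O, Rmult_1_r in M0. rewrite pow_1 in M1.
  set (t := (91125 / 117649) ^ 60) in *.
  rewrite <- M0 in D.
  replace (moment nu 1) with (99999999791457 / 10 ^ 6) in D
    by (rewrite M1; field).
  lra.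
Qed.
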